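(* Let $k\in\mathbb{N}$, $k\ge 1$, and let $$\pi_k:L^2(\Omega,\mu)\to\operatorname{span}\{u_j:1\le j\le k\}$$ denote the orthogonal projection. Then, for all real-valued $h\in W^{1,2}(\Omega,\mu)$, we have $$\int_\Omega h(z)^2\,\mathrm{d}\mu(z)\le\frac{1}{\mu(\Omega)}\left(\int_\Omega h(z)\,\mathrm{d}\mu(z)\right)^2+\frac{1}{\lambda_1}\|\nabla\pi_kh\|_{L^2(\Omega,\mu)}^2+\frac{1}{\lambda_{k+1}}\int_\Omega|\nabla h(z)|^2\,\mathrm{d}\mu(z).$$
   Context: $\Omega\subset\mathbb{C}\simeq\mathbb{R}^2$ is a bounded domain, $F_1:\Omega\to\mathbb{C}$ is holomorphic with $|F_1|>0$ on $\Omega$, and $\mu$ is the measure $\mathrm{d}\mu=|F_1(z)|^2\,\mathrm{d}z$ ($\mathrm{d}z$ being two-dimensional Lebesgue measure), with $\mu(\Omega)<\infty$. $W^{1,2}(\Omega,\mu)$ is the space of $h\in L^2(\Omega,\mu)$ with weak gradient $\nabla h\in L^2(\Omega,\mu)$. It is assumed that $(\Omega,\mu)$ is sufficiently well behaved that the Neumann Laplacian of $(\Omega,\mu)$, i.e. the operator associated with the Dirichlet form $\int_\Omega\nabla u\cdot\nabla v\,\mathrm{d}\mu$ on $W^{1,2}(\Omega,\mu)\subset L^2(\Omega,\mu)$, has discrete spectrum $0=\lambda_0<\lambda_1\le\lambda_2\le\dots$ (with $\lambda_j\to\infty$), with a corresponding orthonormal basis $(u_j)_{j\ge0}$ of $L^2(\Omega,\mu)$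 consisting of real-valued eigenfunctions $u_j\in W^{1,2}(\Omega,\mu)$, where $u_0$ is constant. That is, $-\Delta u_j=\lambda_ju_j$ in $(\Omega,\mu)$ with $\partial u_j/\partial n=0$ on $\partial\Omega$, understood in the weak sense $$\int_\Omega\nabla u_j\cdot\nabla v\,\mathrm{d}\mu=\lambda_j\int_\Omega u_jv\,\mathrm{d}\mu\qquad\text{for all real-valued } v\in W^{1,2}(\Omega,\mu).$$ In particular, $\lambda_1=\inf\left\{\int_\Omega|\nabla f|^2\,\mathrm{d}\mu\big/\int_\Omega|f|^2\,\mathrm{d}\mu\right\}$ over nonzero $f$ with $\int_\Omega f\,\mathrm{d}\mu=0$. *)

(* Defs.v *)
From HB Require Import structures.
From mathcomp Require Import all_boot all_order all_algebra.
From mathcomp Require Import all_classical all_reals all_analysis.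
From mathcomp Require Import complex.
Set Implicit Arguments.
Unset Strict Implicit.
Unset Printing Implicit Defensive.
Import Order.TTheory GRing.Theory Num.Theory.
Import numFieldNormedType.Exports.
Local Open Scope classical_set_scope.
Local Open Scope ring_scope.
Local Open Scope complex_scope.

(* [measurableTypeR R] is convertible to [R]; it makes inference find the Borel
   sigma-algebra on each factor, hence the product one on the plane. *)
Notation plane R := (measurableTypeR R * measurableTypeR R)%type.

Definition to_complex (R : realType) (z : plane R) : R[i] := z.1 +i* z.2.

Definition area (R : realType) : {measure set (plane R) -> \bar R} :=
  (lebesgue_measure \x lebesgue_measure)%E.

Definition domain (R : realType) (Omega : set (plane R)) : Prop :=
  [/\ open Omega, connected Omega & Omega !=set0].

(* [R[i]^o] is [R[i]] as a normed space over itself, so that this is complex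
   differentiability. *)
Definition holomorphic_on (R : realType) (Omega : set (plane R))
    (F : R[i] -> R[i]) : Prop :=
  forall z, Omega z -> derivable (F : R[i]^o -> R[i]^o) (to_complex z) 1.

(* [mu] is |F|^2 dz on [Omega], extended by 0 to the whole plane. *)
Definition weighted_area (R : realType) (Omega : set (plane R))
    (F : R[i] -> R[i]) (mu : {measure set (plane R) -> \bar R}) : Prop :=
  forall A, measurable A ->
    mu A = (\int[area R]_(z in A `&` Omega)
              (ComplexField.Normc.normc (F (to_complex z)) ^+ 2)%:E)%E.

(* Since mu gives no mass to the complement of Omega, an element of
   L^2(Omega, mu) is represented by a measurable function on the whole plane,
   whose values off Omega are irrelevant. *)
Notation L2 mu := (Lfun mu 2%:E).

Definition L2_dot (R : realType) (Omega : set (plane R))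
    (mu : {measure set (plane R) -> \bar R}) (f g : plane R -> R) : R :=
  \int[mu]_(z in Omega) (f z * g z).

Definition axis (R : realType) (i : bool) : plane R :=
  if i then (0, 1) else (1, 0).

Fixpoint continuously_differentiable (R : realType) (n : nat) (f : plane R -> R) :
    Prop :=
  if n is m.+1 then
    continuous f /\ forall i, (forall z, derivable f z (axis R i)) /\
      continuously_differentiable m ('D_(axis R i) f)
  else continuous f.

Definition test_function (R : realType) (Omega : set (plane R))
    (phi : plane R -> R) : Prop :=
  [/\ forall n, continuously_differentiable n phi,
      compact (closure [set z | phi z != 0]) &
      closure [set z | phi z != 0] `<=` Omega].

(* [g] is a weak partial derivative of [h] lying in L^2(Omega, mu). The
   integration by parts is with respect to dz, not mu. *)
Definition is_weak_partial (R : realType) (Omega : set (plane R))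
    (mu : {measure set (plane R) -> \bar R}) (i : bool)
    (h g : plane R -> R) : Prop :=
  g \in L2 mu /\
  forall phi, test_function Omega phi ->
    \int[area R]_(z in Omega) (h z * 'D_(axis R i) phi z) =
    - \int[area R]_(z in Omega) (g z * phi z).

Definition W12 (R : realType) (Omega : set (plane R))
    (mu : {measure set (plane R) -> \bar R}) : set (plane R -> R) :=
  [set h | h \in L2 mu /\
           forall i, exists g, is_weak_partial Omega mu i h g].

(* A representative of the weak gradient, which is unique up to mu-null sets;
   only meaningful on [W12 Omega mu]. *)
Definition weak_partial (R : realType) (Omega : set (plane R))
    (mu : {measure set (plane R) -> \bar R}) (i : bool) (h : plane R -> R) :
    plane R -> R :=
  get (is_weak_partial Omega mu i h).

Definition grad (R : realType) (Omega : set (plane R))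
    (mu : {measure set (plane R) -> \bar R}) (h : plane R -> R) (z : plane R) :
    plane R :=
  (weak_partial Omega mu false h z, weak_partial Omega mu true h z).

Definition dot (R : realType) (v w : plane R) : R := v.1 * w.1 + v.2 * w.2.

Definition dirichlet_form (R : realType) (Omega : set (plane R))
    (mu : {measure set (plane R) -> \bar R}) (u v : plane R -> R) : R :=
  \int[mu]_(z in Omega) dot (grad Omega mu u z) (grad Omega mu v z).

Definition vector_L2_norm (R : realType) (Omega : set (plane R))
    (mu : {measure set (plane R) -> \bar R}) (G : plane R -> plane R) : R :=
  Num.sqrt (\int[mu]_(z in Omega) dot (G z) (G z)).

Definition neumann_eigenfunction (R : realType) (Omega : set (plane R))
    (mu : {measure set (plane R) -> \bar R}) (l : R) (u : plane R -> R) :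
    Prop :=
  W12 Omega mu u /\
  forall v, W12 Omega mu v ->
    dirichlet_form Omega mu u v = l * L2_dot Omega mu u v.

Definition orthonormal_basis (R : realType) (Omega : set (plane R))
    (mu : {measure set (plane R) -> \bar R}) (u : nat -> plane R -> R) : Prop :=
  [/\ forall j, u j \in L2 mu,
      forall i j, L2_dot Omega mu (u i) (u j) = (i == j)%:R &
      forall f, f \in L2 mu -> forall e : R, 0 < e ->
        exists n (c : nat -> R),
          let g z := f z - \sum_(0 <= j < n) c j * u j z in
          L2_dot Omega mu g g < e].

Definition neumann_spectrum (R : realType) (Omega : set (plane R))
    (mu : {measure set (plane R) -> \bar R}) (lambda : nat -> R)
    (u : nat -> plane R -> R) : Prop :=
  [/\ lambda 0%N = 0 /\ 0 < lambda 1%N,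
      (forall j, lambda j <= lambda j.+1) /\ (lambda j @[j --> \oo] --> +oo),
      orthonormal_basis Omega mu u,
      forall j, neumann_eigenfunction Omega mu (lambda j) (u j) &
      exists c : R, {ae mu, forall z, u 0%N z = c}].

Definition span_modes (R : realType) (u : nat -> plane R -> R) (k : nat) :
    set (plane R -> R) :=
  [set p | exists c : nat -> R,
     p = fun z => \sum_(1 <= j < k.+1) c j * u j z].

Definition orthogonal_projection (R : realType) (Omega : set (plane R))
    (mu : {measure set (plane R) -> \bar R}) (V : set (plane R -> R))
    (P : (plane R -> R) -> plane R -> R) : Prop :=
  forall f, f \in L2 mu ->
    V (P f) /\ forall v, V v -> L2_dot Omega mu (fun z => f z - P f z) v = 0.

(* Main.v *)
Require Import Defs.
From HB Require Import structures.
From mathcomp Require Import all_boot all_order all_algebra.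
From mathcomp Require Import all_classical all_reals all_analysis.
From mathcomp Require Import complex.
From mathcomp Require Import measurable_realfun ring.
Set Implicit Arguments.
Unset Strict Implicit.
Unset Printing Implicit Defensive.
Import Order.TTheory GRing.Theory Num.Theory.
Import numFieldNormedType.Exports.
Local Open Scope classical_set_scope.
Local Open Scope ring_scope.
Local Open Scope complex_scope.

(** Write a_j = <h, u_j>. The eigenfunction equation gives
    <grad u_j, grad v> = lambda_j <u_j, v> for every v in W^{1,2}, so the fields
    grad u_j (j >= 1) are orthogonal with squared norms lambda_j. Bessel's
    inequality for them yields sum_j lambda_j a_j^2 <= ||grad h||^2 and
    sum_{j <= k} lambda_j a_j^2 <= ||grad pi_k h||^2; Bessel makes it unnecessary
    to know that the chosen weak gradients depend linearly on the function. Then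
    split Parseval's sum for ||h||^2 at j = 0 and j = k.
    That pi_k h lies in W^{1,2} requires the integrals against test functions to
    converge: |F_1| is bounded below on compact subsets of Omega, so that
    L^2(mu) functions are locally integrable for the Lebesgue measure. *)

(** * Topology and measurability on the plane, and local behaviour of [|F|] *)

Lemma open_plane_measurable (R : realType) (A : set (plane R)) :
  open A -> measurable A.
Proof.
move=> oA.
pose B (q : rat * rat * rat) : set (plane R) :=
  (ball (ratr q.1.1 : R) (ratr q.2)) `*` (ball (ratr q.1.2 : R) (ratr q.2)).
(* Balls of the plane are squares, hence measurable for the product sigma-algebra; those with
   rational centre and radius contained in [A] form a countable cover of it. *)
have -> : A = \bigcup_(q in [set q | B q `<=` A]) B q.
  apply/seteqP; split; last by move=> x [q + Bqx]; exact.
  move=> x /= Ax.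
  have := open_nbhs_nbhs (conj oA Ax).
  rewrite -nbhs_ballE => -[e /= e0 xeA].
  have [r /andP[r0 re]] : exists r : rat, 0 < (ratr r : R) < e / 2.
    have /rat_in_itvoo[r] : (0 : R) < e / 2 by rewrite divr_gt0.
    by rewrite in_itv => ?; exists r.
  have rat_near (y : R) : exists q : rat, ball (ratr q : R) (ratr r) y.
    have /rat_in_itvoo[q] : y - ratr r < y + ratr r.
      by rewrite ltrBlDr -addrA ltrDl addr_gt0.
    by rewrite in_itv/= => qr; exists q; rewrite /ball/= ltr_distl.
  have [q1 hq1] := rat_near x.1; have [q2 hq2] := rat_near x.2.
  exists (q1, q2, r) => //= y [/= y1 y2]; apply: xeA.
  have close (a b q : R) : ball q (ratr r) a -> ball q (ratr r) b -> ball a e b.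
    move=> qa qb; apply: (@ball_split _ _ q); apply: le_ball (ltW re) _ _ => //.
    exact: ball_sym.
  by split; [exact: close hq1 y1|exact: close hq2 y2].
rewrite bigcup_mkcond; apply: countable_bigcupT_measurable => //.
move=> q; case: ifPn => // _.
by apply: measurableX; rewrite (@ball_itv R); exact: measurable_itv.
Qed.

Lemma continuous_plane_measurable (R : realType) (f : plane R -> R) :
  continuous f -> measurable_fun setT f.
Proof.
move=> /continuousP cf; apply: (measurability _ (RGenOpens.measurableE R)).
move=> _ [_ [a [b ->] <-]]; rewrite setTI.
apply: open_plane_measurable.
exact/cf/interval_open.
Qed.

Lemma continuous_to_complex (R : realType) :
  continuous (@to_complex R : plane R -> R[i]^o).
Proof.
move=> z; apply/cvgrPdist_lt => -[e e'].
rewrite ltcE /= => /andP[/eqP -> e0].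
have e20 : 0 < e / 2 by rewrite divr_gt0.
exists (ball (z.1 : R) (e / 2), ball (z.2 : R) (e / 2)).
  by split; exact: nbhsx_ballx.
move=> x [z1x z2x].
(* The modulus is at most the sum of the absolute values of the coordinates, hence the radii
   [e / 2]. *)
have h : `|z.1 - x.1| + `|z.2 - x.2| < e by rewrite [e]splitr ltrD.
rewrite normc_def ltcR /=; apply: le_lt_trans h.
rewrite -(ler_pXn2r (n := 2)) ?nnegrE ?addr_ge0//.
rewrite sqr_sqrtr ?addr_ge0 ?sqr_ge0// [leRHS]sqrrD !real_normK ?num_real//.
by rewrite lerD2r lerDl mulrn_wge0// mulr_ge0.
Qed.

Lemma norm_normc (R : rcfType) (x : R[i]) :
  `|x| = (ComplexField.Normc.normc x)%:C.
Proof. by case: x => a b; rewrite normc_def. Qed.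

(** Complex differentiability gives continuity, so near [z] the modulus stays above half of its
    value at [z]. *)
Lemma holomorphic_bounded_below_near (R : realType) (Omega : set (plane R))
    (F : R[i] -> R[i]) (z : plane R) :
  holomorphic_on Omega F -> Omega z -> 0 < `|F (to_complex z)| ->
  exists2 m : R, 0 < m &
    \forall x \near z, m <= ComplexField.Normc.normc (F (to_complex x)).
Proof.
move=> hF Oz Fz0.
have /derivable1_diffP/differentiable_continuous cF := hF z Oz.
have /cvgrPdist_lt cFz : {for z, continuous ((F : R[i]^o -> R[i]^o) \o @to_complex R)}.
  by apply: continuous_comp; [exact: continuous_to_complex|exact: cF].
pose n := ComplexField.Normc.normc (F (to_complex z)).
have n0 : 0 < n by move: Fz0; rewrite norm_normc ltcR.
exists (n / 2); first exact: divr_gt0.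
have e0 : 0 < (n / 2)%:C by rewrite ltcR divr_gt0.
move/(_ _ e0) : cFz.
apply: filterS => x /=; rewrite norm_normc ltcR => lt_n2.
have := ler_normD (F (to_complex x))
  (F (to_complex z) - F (to_complex x)).
rewrite [X in `|X|]addrC subrK !norm_normc -rmorphD lecR -/n {1}[n]splitr => le_n.
by rewrite -(lerD2r (n / 2)); apply: le_trans le_n _; rewrite lerD2l ltW.
Qed.

(** * Comparison of integrals over different domains and for different measures *)

Lemma nonmeasurable_ge0_le_integral d (T : measurableType d) (R : realType)
    (mu : {measure set T -> \bar R}) (D E : set T) (f g : T -> \bar R) :
  (forall x, D x -> 0 <= f x)%E -> (forall x, E x -> 0 <= g x)%E ->
  D `<=` E -> (forall x, D x -> f x <= g x)%E ->
  (\int[mu]_(x in D) f x <= \int[mu]_(x in E) g x)%E.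
Proof.
move=> f0 g0 DE fg; rewrite !ge0_integralE//.
(* Both integrals are suprema over simple functions below the integrand extended by 0; each
   competitor for [f] on [D] is one for [g] on [E]. *)
apply: ge_ereal_sup => _ [h/= hf <-]; apply: ereal_sup_ubound; exists h => //= x.
apply: le_trans (hf x) _; rewrite !patchE.
have [Dx|Dx] := boolP (x \in D).
  by rewrite (mem_set (DE _ (set_mem Dx))) fg//; exact: set_mem.
by case: ifPn => // /set_mem/g0.
Qed.

Section ge0_le_measure_integral_on.
Import HBNNSimple.

Lemma ge0_le_measure_integral_on d (T : measurableType d) (R : realType)
    (m1 m2 : {measure set T -> \bar R}) (D : set T) (f : T -> \bar R) :
  measurable D -> (forall A, measurable A -> A `<=` D -> m1 A <= m2 A)%E ->
  (forall x, D x -> 0 <= f x)%E ->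
  (\int[m1]_(x in D) f x <= \int[m2]_(x in D) f x)%E.
Proof.
move=> mD m12 f0; rewrite !ge0_integralE//.
apply: ge_ereal_sup => _ [h/= hf <-].
apply: le_ereal_sup_tmp; exists (sintegral m2 h); first by exists h.
rewrite !sintegralE; apply: lee_fsum => [|r _]; first exact: fimfunP.
have [->|r0] := eqVneq r 0; first by rewrite !mul0e.
have [rneg|rpos] := ltP r 0.
  rewrite preimage10 ?measure0//.
  by move=> [x _ hxr]; move: rneg; rewrite -hxr ltNge fun_ge0.
apply: lee_wpmul2l; first by rewrite lee_fin.
(* A level set of [h] at [r > 0] lies in [D], because the integrand extended by 0 bounds [h] by 0
   elsewhere. *)
apply: m12 => // x /= hx; apply: contrapT => nDx.
have := hf x; rewrite patchE memNset// hx lee_fin leNgt.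
by rewrite lt_neqAle eq_sym r0 rpos.
Qed.

End ge0_le_measure_integral_on.

(** * Uniform bounds on compact sets *)

Lemma compact_ex_lower_bound (R : realType) (T : topologicalType) (K : set T)
    (f : T -> R) :
  compact K ->
  (forall x, K x -> exists2 m, 0 < m & \forall y \near x, m <= f y) ->
  exists2 m, 0 < m & forall x, K x -> m <= f x.
Proof.
move=> /compact_near_coveringP cK loc.
(* The near-covering form of compactness, along [m] tending to 0 from the right, makes the local
   bounds uniform. *)
have [x Kx|m [m0 mf]] := @filter_ex _ _ _ _ (filterI (nbhs_right_gt 0)
    (cK R (0^'+) (fun m x => m <= f x) _ _)); last by exists m.
have [m m0 mf] := loc x Kx.
exists ([set y | m <= f y], [set e | e <= m]).
  by split=> //; exact: nbhs_right_le.
by move=> [y e] [/= mfy em]; exact: le_trans mfy.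
Qed.

(** An upper bound for [|f|] is a positive lower bound for the inverse of [1 + |f|], so the previous
    lemma applies. *)
Lemma compact_ex_norm_bound (R : realType) (T : topologicalType) (K : set T)
    (f : T -> R) :
  compact K -> continuous f -> exists2 M, 0 < M & forall x, K x -> `|f x| <= M.
Proof.
move=> cK cf.
have [|m m0 mf] := @compact_ex_lower_bound R T K (fun x => (1 + `|f x|)^-1) cK.
  move=> x _; exists (2 + `|f x|)^-1; first by rewrite invr_gt0 ltr_pwDl.
  move/cvgrPdist_lt : (cf x) => /(_ _ ltr01); apply: filterS => y fxy.
  rewrite lef_pV2 ?posrE ?ltr_pwDl// -[2]/(1 + 1) -addrA lerD2l.
  have := ler_normD (f y - f x) (f x); rewrite subrK distrC => /le_trans; apply.
  by rewrite lerD2r ltW.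
exists m^-1 => [|x Kx]; first by rewrite invr_gt0.
have := mf x Kx; rewrite -[X in X <= _]invrK lef_pV2 ?posrE ?invr_gt0 ?ltr_pwDl//.
by apply: le_trans; rewrite lerDr.
Qed.

Lemma plane_hausdorff (R : realType) : hausdorff_space (plane R).
Proof. exact: (@norm_hausdorff R (R * R)%type). Qed.

Lemma compact_plane_measurable (R : realType) (K : set (plane R)) :
  compact K -> measurable K.
Proof.
move=> /(compact_closed (@plane_hausdorff R)) /closed_openC.
by move=> /open_plane_measurable/measurableC; rewrite setCK.
Qed.

(** * Lebesgue measure against [mu], and local integrability *)

Lemma weighted_area_setT (R : realType) (Omega : set (plane R))
    (F : R[i] -> R[i]) (mu : {measure set (plane R) -> \bar R}) :
  measurable Omega -> weighted_area Omega F mu -> mu setT = mu Omega.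
Proof. by move=> mO muE; rewrite !muE// setTI setIid. Qed.

(** If [m] bounds [|F|] below on [K], the density of [mu] is at least [m ^+ 2] there, whence the
    constant [(m ^+ 2)^-1]. *)
Lemma weighted_area_ge_area (R : realType) (Omega K : set (plane R))
    (F : R[i] -> R[i]) (mu : {measure set (plane R) -> \bar R}) :
  holomorphic_on Omega F -> (forall z, Omega z -> 0 < `|F (to_complex z)|) ->
  weighted_area Omega F mu -> compact K -> K `<=` Omega ->
  exists2 m : R, 0 < m &
    forall A, measurable A -> A `<=` K -> (area R A <= m%:E * mu A)%E.
Proof.
move=> hF F0 muE cK KO.
have [x /KO Ox|m m0 mF] := @compact_ex_lower_bound R _ K
    (fun z => ComplexField.Normc.normc (F (to_complex z))) cK.
  exact: holomorphic_bounded_below_near hF Ox (F0 _ Ox).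
have m20 : 0 < m ^+ 2 by rewrite exprn_gt0.
exists (m ^+ 2)^-1 => [|A mA AK]; first by rewrite invr_gt0.
rewrite -(@lee_pmul2l _ (m ^+ 2)%:E) ?lte_fin// muleA -EFinM.
rewrite mulfV ?gt_eqF// mul1e muE// -integral_cst//.
apply: nonmeasurable_ge0_le_integral => /=.
- by move=> x _; rewrite lee_fin ltW.
- by move=> x _; rewrite lee_fin sqr_ge0.
- by move=> x Ax; split=> //; exact/KO/AK.
- by move=> x /AK Kx; rewrite lee_fin lerXn2r ?nnegrE ?(ltW m0) ?(le_trans (ltW m0))// mF.
Qed.

(** As [mu] is finite, [f] is [mu]-integrable, hence Lebesgue integrable on [K] by comparison of the
    measures; the bounded factor [psi] vanishes off [K]. *)
Lemma L2_locally_area_integrable (R : realType) (Omega K : set (plane R))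
    (F : R[i] -> R[i]) (mu : {measure set (plane R) -> \bar R})
    (f psi : plane R -> R) :
  open Omega -> holomorphic_on Omega F ->
  (forall z, Omega z -> 0 < `|F (to_complex z)|) ->
  weighted_area Omega F mu -> (mu Omega < +oo)%E ->
  compact K -> K `<=` Omega -> f \in L2 mu ->
  continuous psi -> (forall z, ~ K z -> psi z = 0) ->
  (area R).-integrable Omega (EFin \o (fun z => f z * psi z)).
Proof.
move=> oO hF F0 muE muO cK KO f2 cpsi psi0.
have mO := open_plane_measurable oO.
have mK := compact_plane_measurable cK.
have [M M0 psiM] := compact_ex_norm_bound cK cpsi.
have [m m0 aream] := weighted_area_ge_area hF F0 muE cK KO.
have mf : measurable_fun setT f by move: f2; rewrite inE => /andP[]; rewrite inE.
have fK : mu.-integrable K (EFin \o f).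
  have muT : mu setT \is a fin_num.
    by rewrite ge0_fin_numE// (weighted_area_setT mO muE).
  apply: integrableS (@measurableT _ _) mK (@subsetT _ _) _.
  exact/Lfun1_integrable/(Lfun_subset12 muT).
have afK : (area R).-integrable K (EFin \o f).
  apply/integrableP; split.
    by apply: measurable_funTS; exact/measurable_EFinP.
  pose m' := NngNum (ltW m0).
  apply: (@le_lt_trans _ _ (\int[mscale m' mu]_(x in K) `|(f x)%:E|)%E).
    by apply: ge0_le_measure_integral_on.
  rewrite ge0_integral_mscale//; last first.
    by apply: measurable_funTS; apply: measurableT_comp => //; exact/measurable_EFinP.
  by rewrite lte_mul_pinfty// ?lee_fin ?(ltW m0)//; case/integrableP : fK.
(* Domination by [M * f] extended by 0 off [K], where [M] bounds [|psi|] on [K]. *)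
apply: (@le_integrable _ _ _ _ _ _ _ (EFin \o ((fun z => M * f z) \_ K))) => //.
- apply/measurable_EFinP/measurable_funTS/measurable_funM => //.
  exact: continuous_plane_measurable.
- move=> z _ /=; rewrite lee_fin patchE; case: ifPn => [/set_mem Kz|/negP nKz].
    by rewrite !normrM mulrC ler_wpM2r// (gtr0_norm M0) psiM.
  by rewrite psi0 ?mulr0// => Kz; apply: nKz; rewrite inE.
- rewrite -restrict_EFin; apply: integrableS (@measurableT _ _) mO (@subsetT _ _) _.
  by apply/(integrable_mkcond _ mK); exact: (integrableZl mK M afK).
Qed.

Lemma derive_off_support (R : realType) (V : normedModType R) (f : V -> R) (v x : V) :
  ~ closure [set z | f z != 0] x -> 'D_v f x = 0.
Proof.
move=> nx.
have f0 : {near x, f =1 cst 0}.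
  have : open_nbhs x (~` closure [set z | f z != 0]).
    by split=> //; apply: closed_openC; exact: closed_closure.
  move=> /open_nbhs_nbhs; apply: filterS => y /= ny; apply/eqP/negP => /negP fy.
  by apply: ny; exact: subset_closure.
by rewrite (near_eq_derive _ f0) derive_cst.
Qed.

Lemma L2_linear (R : realType) (mu : {measure set (plane R) -> \bar R}) a
    (f g : plane R -> R) :
  f \in L2 mu -> g \in L2 mu -> (fun z => a * f z + g z) \in L2 mu.
Proof.
move=> f2 g2.
have p1 : (1 <= 2%:E :> \bar R)%E by rewrite lee_fin ler1n.
exact: (Lfun_submod_closed mu p1).2 a _ _ f2 g2.
Qed.

(** * Linear structure of the Sobolev space *)

Section W12_linear.
Variables (R : realType) (Omega : set (plane R)) (F : R[i] -> R[i]).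
Variable mu : {measure set (plane R) -> \bar R}.
Hypothesis oO : open Omega.
Hypothesis hF : holomorphic_on Omega F.
Hypothesis F0 : forall z, Omega z -> 0 < `|F (to_complex z)|.
Hypothesis muE : weighted_area Omega F mu.
Hypothesis muO : (mu Omega < +oo)%E.

Let mO := open_plane_measurable oO.

(** Splitting the two sides of the integration by parts requires integrable summands; local
    integrability supplies this, since [phi] and its partial derivative are continuous and vanish
    off the compact support of [phi]. *)
Lemma weak_partial_linear i a h1 g1 h2 g2 : h1 \in L2 mu -> h2 \in L2 mu ->
  is_weak_partial Omega mu i h1 g1 -> is_weak_partial Omega mu i h2 g2 ->
  is_weak_partial Omega mu i (fun z => a * h1 z + h2 z) (fun z => a * g1 z + g2 z).
Proof.
move=> h12 h22 [g12 hg1] [g22 hg2]; split; first exact: L2_linear.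
move=> phi tphi; have [/(_ 1%N)/= [cphi /(_ i)[_ cD]] cK KO] := tphi.
have int f psi := @L2_locally_area_integrable _ _ _ _ _ f psi oO hF F0 muE muO cK KO.
have phi0 z : ~ closure [set z | phi z != 0] z -> phi z = 0.
  by move=> nz; apply/eqP/negP => /negP pz; apply: nz; exact: subset_closure.
have D0 z := @derive_off_support R (plane R) phi (axis R i) z.
have lin f g psi : f \in L2 mu -> g \in L2 mu -> continuous psi ->
    (forall z, ~ closure [set z | phi z != 0] z -> psi z = 0) ->
    \int[area R]_(z in Omega) ((a * f z + g z) * psi z) =
    a * \int[area R]_(z in Omega) (f z * psi z)
    + \int[area R]_(z in Omega) (g z * psi z).
  move=> f2 g_2 cpsi psi0.
  under eq_Rintegral do rewrite mulrDl -mulrA.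
  rewrite RintegralD ?RintegralZl//; try exact: int.
  exact: (integrableZl mO a (int f psi f2 cpsi psi0)).
by rewrite !lin// hg1// hg2// mulrN opprD.
Qed.

Lemma W12_linear a h1 h2 : W12 Omega mu h1 -> W12 Omega mu h2 ->
  W12 Omega mu (fun z => a * h1 z + h2 z).
Proof.
move=> [h12 d1] [h22 d2]; split; first exact: L2_linear.
move=> i; have [[g1 dg1] [g2 dg2]] := (d1 i, d2 i).
by exists (fun z => a * g1 z + g2 z); exact: weak_partial_linear.
Qed.

Lemma W12_sum (u : nat -> plane R -> R) (c : nat -> R) m n :
  (forall j, W12 Omega mu (u j)) ->
  W12 Omega mu (fun z => \sum_(m <= j < m + n) c j * u j z).
Proof.
move=> uW; elim: n => [|n IH].
  (* The empty sum is the zero function, obtained as [- u 0 + u 0]. *)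
  have := W12_linear (-1) (uW 0%N) (uW 0%N).
  congr W12; apply/funext => z; rewrite addn0 big_geq//.
  by rewrite mulN1r addNr.
have := W12_linear (c (m + n)%N) (uW (m + n)%N) IH.
congr W12; apply/funext => z.
by rewrite addnS big_nat_recr ?leq_addr//= addrC.
Qed.

End W12_linear.

(** * Bessel's inequality for an abstract orthogonal family *)

Section orthogonal_family.
Variables (R : realFieldType) (V : lmodType R) (S : V -> Prop) (B : V -> V -> R).
Hypothesis S_linear : forall a x y, S x -> S y -> S (a *: x + y).
Hypothesis B_linear : forall a x y z, S x -> S y -> S z ->
  B (a *: x + y) z = a * B x z + B y z.
Hypothesis B_sym : forall x y, B x y = B y x.
Variables (g : nat -> V) (w : nat -> R).
Hypothesis S_g : forall j, S (g j).
Hypothesis w_gt0 : forall j, 0 < w j.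
Hypothesis B_g : forall i j, B (g i) (g j) = (i == j)%:R * w i.

(** Orthogonality: subtracting multiples of earlier [g j] leaves later coefficients unchanged.
    Linearity of [B] is confined to [S] because the integrals to which this is applied split only
    for square-integrable arguments. *)
Lemma dot_orthogonal_residual b x n : S x ->
  let y := x - \sum_(0 <= j < n) b j *: g j in
  S y /\ (forall i, (n <= i)%N -> B y (g i) = B x (g i)).
Proof.
move=> Sx; elim: n => [|n [Sy yg]] /=; first by rewrite big_geq// subr0.
rewrite big_nat_recr//= opprD addrA addrC -scaleNr; split; first exact: S_linear.
move=> i ni; rewrite B_linear// B_g yg 1?ltnW//.
by rewrite (ltn_eqF ni) mul0r mulr0 add0r.
Qed.

(** Complete the square in each [b j]: subtracting [b j *: g j] adds
    [w j * b j ^+ 2 - 2 * b j * B x (g j)] to the square. *)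
Lemma sqr_orthogonal_residual b x n : S x ->
  let y := x - \sum_(0 <= j < n) b j *: g j in
  B y y = B x x - \sum_(0 <= j < n) B x (g j) ^+ 2 / w j
          + \sum_(0 <= j < n) w j * (b j - B x (g j) / w j) ^+ 2.
Proof.
move=> Sx; elim: n => [|n]; first by rewrite /= !big_geq// !(subr0, addr0).
have [Sy yg] := dot_orthogonal_residual b n Sx.
move=> /= IH; rewrite !big_nat_recr//=.
set y := x - \sum_(0 <= j < n) b j *: g j in Sy yg IH *.
rewrite opprD addrA -/y [y + _]addrC -scaleNr.
have Sy' : S (- b n *: g n + y) by exact: S_linear.
rewrite B_linear// [B (g n) _]B_sym [B y (_ + _)]B_sym !B_linear//.
rewrite B_g eqxx mul1r [B (g n) y]B_sym yg// IH.
by field; rewrite gt_eqF.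
Qed.

Lemma le_orthogonal_residual b x n : S x ->
  let y := x - \sum_(0 <= j < n) b j *: g j in
  B x x - \sum_(0 <= j < n) B x (g j) ^+ 2 / w j <= B y y.
Proof.
move=> Sx /=; rewrite sqr_orthogonal_residual// lerDl sumr_ge0// => j _.
by rewrite mulr_ge0 ?sqr_ge0 ?ltW.
Qed.

(** For the optimal coefficients [B x (g j) / w j] the completed squares vanish, and what is left is
    the square of the residual. *)
Lemma bessel x n : (forall y, 0 <= B y y) -> S x ->
  \sum_(0 <= j < n) B x (g j) ^+ 2 / w j <= B x x.
Proof.
move=> B_ge0 Sx; rewrite -subr_ge0.
have := sqr_orthogonal_residual (fun j => B x (g j) / w j) n Sx.
rewrite /= [X in _ = _ + X]big1 ?addr0 => [<- //|j _].
by rewrite subrr expr0n mulr0.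
Qed.

End orthogonal_family.

(** * Inner products of square-integrable functions and vector fields *)

Section L2_products.
Variables (R : realType) (Omega : set (plane R)).
Variable mu : {measure set (plane R) -> \bar R}.
Hypothesis mO : measurable Omega.

Lemma L2_mul_integrable f g : f \in L2 mu -> g \in L2 mu ->
  mu.-integrable Omega (EFin \o (fun z => f z * g z)).
Proof.
move=> f2 g2; apply: integrableS (@measurableT _ _) mO (@subsetT _ _) _.
exact/Lfun1_integrable/Lfun2_mul_Lfun1.
Qed.

Lemma L2_dotC f g : L2_dot Omega mu f g = L2_dot Omega mu g f.
Proof. by apply: eq_Rintegral => z _; rewrite mulrC. Qed.

Lemma L2_dot_linear a f g h : f \in L2 mu -> g \in L2 mu -> h \in L2 mu ->
  L2_dot Omega mu (fun z => a * f z + g z) h =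
  a * L2_dot Omega mu f h + L2_dot Omega mu g h.
Proof.
move=> f2 g2 h2; rewrite /L2_dot.
under eq_Rintegral do rewrite mulrDl -mulrA.
rewrite RintegralD ?RintegralZl//; try exact: L2_mul_integrable.
exact: (integrableZl mO a (L2_mul_integrable f2 h2)).
Qed.

Definition L2_field (G : plane R -> plane R) : Prop :=
  (fun z => (G z).1) \in L2 mu /\ (fun z => (G z).2) \in L2 mu.

(** On gradients this unfolds to [dirichlet_form]; on the diagonal it is the radicand of
    [vector_L2_norm]. *)
Definition field_dot (G H : plane R -> plane R) : R :=
  \int[mu]_(z in Omega) dot (G z) (H z).

Lemma field_dotE G H : L2_field G -> L2_field H ->
  field_dot G H = L2_dot Omega mu (fun z => (G z).1) (fun z => (H z).1)
                  + L2_dot Omega mu (fun z => (G z).2) (fun z => (H z).2).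
Proof.
by move=> [G1 G2] [H1 H2]; rewrite /field_dot RintegralD//; exact: L2_mul_integrable.
Qed.

Lemma L2_field_linear a (G H : plane R -> plane R) : L2_field G -> L2_field H ->
  L2_field (a *: (G : plane R -> R * R) + (H : plane R -> R * R)).
Proof. by move=> [G1 G2] [H1 H2]; split; exact: L2_linear. Qed.

Lemma field_dotC G H : field_dot G H = field_dot H G.
Proof. by apply: eq_Rintegral => z _; rewrite /dot mulrC [in X in _ + X]mulrC. Qed.

Lemma field_dot_ge0 G : 0 <= field_dot G G.
Proof. by apply: Rintegral_ge0 => z _; rewrite addr_ge0// -expr2 sqr_ge0. Qed.

Lemma field_dot_linear a (G H K : plane R -> plane R) :
  L2_field G -> L2_field H -> L2_field K ->
  field_dot (a *: (G : plane R -> R * R) + (H : plane R -> R * R)) K =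
  a * field_dot G K + field_dot H K.
Proof.
move=> G2 H2 K2; rewrite !field_dotE//; last exact: L2_field_linear.
move: G2 H2 K2 => [G1 G2] [H1 H2] [K1 K2].
by rewrite !L2_dot_linear//; ring.
Qed.

Lemma L2_field_grad h : W12 Omega mu h -> L2_field (grad Omega mu h).
Proof.
move=> [_ hW]; split.
- by case: (getPex (hW false)).
- by case: (getPex (hW true)).
Qed.

End L2_products.

(** * Consequences of the spectral assumptions *)

Section spectrum.
Variables (R : realType) (Omega : set (plane R)).
Variable mu : {measure set (plane R) -> \bar R}.
Variables (lambda : nat -> R) (u : nat -> plane R -> R).
Hypothesis mO : measurable Omega.
Hypothesis muT : mu setT \is a fin_num.
Hypothesis spectrum : neumann_spectrum Omega mu lambda u.

Lemma lambda_le i j : (i <= j)%N -> lambda i <= lambda j.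
Proof.
case: spectrum => _ [lambdaS _] _ _ _.
by move=> /(homo_leq (@lexx _ _) (fun y x z => @le_trans _ _ y x z) lambdaS).
Qed.

Lemma lambda_gt0 j : (1 <= j)%N -> 0 < lambda j.
Proof. by case: (spectrum) => -[_ l1] _ _ _ _ /lambda_le; exact: lt_le_trans. Qed.

Lemma dirichlet_bessel v n : W12 Omega mu v ->
  \sum_(1 <= j < n.+1) lambda j * L2_dot Omega mu v (u j) ^+ 2 <=
  dirichlet_form Omega mu v v.
Proof.
move=> vW; have [_ _ [_ uu _] eig _] := spectrum.
have uW j : W12 Omega mu (u j) by case: (eig j).
(* The shift leaves out the constant mode, whose weight [lambda 0] is 0, while Bessel divides by the
   weights. *)
pose g j : plane R -> R * R := grad Omega mu (u j.+1).
have gg i j : field_dot Omega mu (g i) (g j) = (i == j)%:R * lambda i.+1.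
  have [_ /(_ _ (uW j.+1))] := eig i.+1.
  by rewrite uu eqSS mulrC.
have := @bessel R (plane R -> R * R)%type (L2_field mu) (field_dot Omega mu)
  (@L2_field_linear _ mu) (@field_dot_linear _ _ _ mO) (@field_dotC _ _ _)
  g (fun j => lambda j.+1) (fun j => L2_field_grad (uW j.+1))
  (fun j => lambda_gt0 (ltn0Sn j)) gg (grad Omega mu v) n (@field_dot_ge0 _ _ _)
  (L2_field_grad vW).
apply: le_trans; rewrite big_add1/= le_eqVlt; apply/orP; left; apply/eqP.
apply: eq_bigr => j _; have [_ /(_ _ vW) E] := eig j.+1.
(* The coefficient of [grad v] on [g j] is [lambda j.+1] times that of [v] on [u j.+1]; squared and
   divided by the weight, one factor [lambda j.+1] remains. *)
rewrite field_dotC [X in _ = X ^+ 2 / _]E L2_dotC.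
have : lambda j.+1 != 0 by rewrite gt_eqF ?lambda_gt0.
by move=> ?; field.
Qed.

(** Completeness provides some approximating combination; the Fourier coefficients of the same
    length do at least as well. *)
Lemma parseval_le h e : h \in L2 mu -> 0 < e ->
  exists n, L2_dot Omega mu h h - \sum_(0 <= j < n) L2_dot Omega mu h (u j) ^+ 2 < e.
Proof.
move=> h2 e0; have [_ _ [u2 uu total] _ _] := spectrum.
have [n [c /= lt_e]] := total h h2 e e0; exists n; apply: le_lt_trans lt_e.
have := @le_orthogonal_residual R (plane R -> R)%type (fun f => f \in L2 mu)
  (L2_dot Omega mu) (@L2_linear _ mu) (@L2_dot_linear _ _ _ mO)
  (@L2_dotC _ _ _) u (fun=> 1) u2 (fun=> ltr01) _ c h n h2.
rewrite (_ : h - _ = fun z => h z - \sum_(0 <= j < n) c j * u j z).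
  move=> res; apply: le_trans (res _) => [|i j]; last by rewrite mulr1.
  rewrite le_eqVlt; apply/orP; left; apply/eqP; congr (_ - _).
  by apply: eq_bigr => j _; rewrite divr1.
by apply/funext => z; rewrite !fctE fct_sumE.
Qed.

Lemma constant_mode h : h \in L2 mu ->
  L2_dot Omega mu h (u 0%N) ^+ 2 = (fine (mu Omega))^-1 * (\int[mu]_(z in Omega) h z) ^+ 2.
Proof.
move=> h2; have [_ _ [u2 uu _] _ [c u0c]] := spectrum.
have m2 f : f \in L2 mu -> measurable_fun Omega f.
  by rewrite inE => /andP[]; rewrite inE => mf _; exact: measurable_funTS.
have dot0 f : f \in L2 mu -> L2_dot Omega mu f (u 0%N) = \int[mu]_(z in Omega) (f z * c).
  move=> f2; congr fine; apply: ae_eq_integral => //.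
  - by apply/measurable_EFinP; apply: measurable_funM; exact: m2.
  - by apply/measurable_EFinP; apply: measurable_funM => //; exact: m2.
  - by apply: filterS u0c => z -> _.
have intc f : f \in L2 mu -> L2_dot Omega mu f (u 0%N) = c * \int[mu]_(z in Omega) f z.
  move=> f2; rewrite dot0// RintegralZr// 1?mulrC//.
  apply: integrableS (@measurableT _ _) mO (@subsetT _ _) _.
  exact/Lfun1_integrable/(Lfun_subset12 muT).
(* The normalisation of [u 0] determines the square of its constant value, and also forces
   [mu Omega] to be nonzero. *)
have c1 : c ^+ 2 * fine (mu Omega) = 1.
  transitivity (L2_dot Omega mu (u 0%N) (u 0%N)); last by rewrite uu.
  rewrite intc// expr2 -mulrA; congr (_ * _).
  rewrite -Rintegral_cst//; congr fine; apply: ae_eq_integral => //.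
  - by apply/measurable_EFinP; exact: m2.
  - by apply: filterS u0c => z -> _.
rewrite intc// exprMn; congr (_ * _).
by apply: (mulIf (x := fine (mu Omega))); [|rewrite c1 mulVf//];
  apply/eqP => m0; move/eqP: c1; rewrite m0 mulr0 eq_sym oner_eq0.
Qed.

(** Each ratio [lambda j / lambda m] is at least 1 for [j >= m], and [1 <= m] makes the denominator
    positive. *)
Lemma sum_le_lambda_sum (a : nat -> R) m n : (1 <= m)%N -> (forall j, 0 <= a j) ->
  \sum_(m <= j < n) a j <= (lambda m)^-1 * \sum_(m <= j < n) lambda j * a j.
Proof.
move=> m1 a_ge0; rewrite mulr_sumr big_seq [leRHS]big_seq; apply: ler_sum => j.
rewrite mem_index_iota => /andP[mj _]; rewrite mulrA ler_peMl//.
by rewrite mulrC ler_pdivlMr ?lambda_gt0// mul1r lambda_le.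
Qed.

End spectrum.

(** * The spectral splitting of the squared norm of [h] *)

Theorem proposition11 (R : realType) (Omega : set (plane R))
    (F1 : R[i] -> R[i]) (mu : {measure set (plane R) -> \bar R})
    (lambda : nat -> R) (u : nat -> plane R -> R) (k : nat)
    (pi_k : (plane R -> R) -> plane R -> R) :
  domain Omega -> bounded_set Omega ->
  holomorphic_on Omega F1 ->
  (forall z, Omega z -> 0 < `|F1 (to_complex z)|) ->
  weighted_area Omega F1 mu ->
  (mu Omega < +oo)%E ->
  neumann_spectrum Omega mu lambda u ->
  (1 <= k)%N ->
  orthogonal_projection Omega mu (span_modes u k) pi_k ->
  forall h : plane R -> R, W12 Omega mu h ->
    \int[mu]_(z in Omega) (h z ^+ 2) <=
      (fine (mu Omega))^-1 * (\int[mu]_(z in Omega) h z) ^+ 2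
      + (lambda 1%N)^-1 * vector_L2_norm Omega mu (grad Omega mu (pi_k h)) ^+ 2
      + (lambda k.+1)^-1 *
          \int[mu]_(z in Omega) dot (grad Omega mu h z) (grad Omega mu h z).
Proof.
move=> [oO _ _] _ hF F0 muE muO spec k1 proj h hW.
have mO := open_plane_measurable oO.
have muT : mu setT \is a fin_num.
  by rewrite ge0_fin_numE// (weighted_area_setT mO muE).
have [_ _ [u2 uu _] eig _] := spec.
have uW j : W12 Omega mu (u j) by case: (eig j).
have [h2 _] := hW.
have [[c pE] orth] := proj h h2.
have pW : W12 Omega mu (pi_k h).
  by rewrite pE -add1n; exact: (W12_sum oO hF F0 muE muO).
have p2 : pi_k h \in L2 mu by case: pW.
(* Each such [u j] is in the span, so the residual [h - pi_k h] is orthogonal to it. *)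
have coef j : (1 <= j < k.+1)%N ->
    L2_dot Omega mu (pi_k h) (u j) = L2_dot Omega mu h (u j).
  move=> jk; have /orth : span_modes u k (u j).
    exists (fun i => (i == j)%:R); apply/funext => z.
    rewrite (bigD1_seq j) ?mem_index_iota ?iota_uniq//= eqxx mul1r.
    by rewrite big1 ?addr0// => i /negPf ->; rewrite mul0r.
  have := L2_dot_linear mO (-1) p2 h2 (u2 j).
  rewrite (_ : (fun z => _) = fun z => h z - pi_k h z) => [->|].
    by rewrite mulN1r addrC => /eqP; rewrite subr_eq0 => /eqP.
  by apply/funext => z; rewrite mulN1r addrC.
rewrite (_ : \int[mu]_(z in Omega) _ = L2_dot Omega mu h h); last first.
  by apply: eq_Rintegral => z _; rewrite expr2.
rewrite /vector_L2_norm sqr_sqrtr; last exact: field_dot_ge0.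
rewrite -(constant_mode mO muT spec h2).
(* Parseval is available only up to [e], so the inequality is proved with an arbitrary positive
   slack. *)
apply/ler_addgt0Pr => e e0.
have [n /ltW le_e] := parseval_le mO spec h2 e0.
pose a j := L2_dot Omega mu h (u j) ^+ 2.
have a_ge0 j : 0 <= a j by exact: sqr_ge0.
(* Lengthening the sum to [n + k.+1] adds nonnegative terms and guarantees that the cut at [k.+1]
   falls inside the range. *)
have le_h : L2_dot Omega mu h h <= \sum_(0 <= j < n + k.+1) a j + e.
  rewrite addrC -lerBlDr; apply: le_trans le_e; rewrite lerD2l lerN2.
  by rewrite [leRHS](big_cat_nat (n := n)) ?leq_addr//= lerDl sumr_ge0.
apply: le_trans le_h _; rewrite lerD2r.
have nk : (k.+1 <= n + k.+1)%N by exact: leq_addl.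
rewrite (big_cat_nat (n := k.+1))//= big_ltn//= -/(a 0%N).
(* Bessel for [pi_k h], whose coefficients of index 1 to [k] are those of [h]. *)
have low : \sum_(1 <= j < k.+1) a j <= (lambda 1%N)^-1 *
    dirichlet_form Omega mu (pi_k h) (pi_k h).
  apply: le_trans (sum_le_lambda_sum spec k.+1 (ltnSn 0) a_ge0) _.
  apply: ler_wpM2l; first by rewrite invr_ge0 ltW ?(lambda_gt0 spec).
  apply: le_trans (dirichlet_bessel mO spec k pW).
  rewrite big_seq [leRHS]big_seq; apply: ler_sum => j.
  by rewrite mem_index_iota => /coef ->.
(* Bessel for [h] itself, after discarding the nonnegative terms of index at most [k]. *)
have high : \sum_(k.+1 <= j < n + k.+1) a j <= (lambda k.+1)^-1 *
    dirichlet_form Omega mu h h.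
  apply: le_trans (sum_le_lambda_sum spec (n + k.+1) (ltn0Sn k) a_ge0) _.
  apply: ler_wpM2l; first by rewrite invr_ge0 ltW ?(lambda_gt0 spec).
  rewrite addnS; apply: le_trans (dirichlet_bessel mO spec (n + k) hW).
  rewrite [leRHS](big_cat_nat (n := k.+1)) ?ltnS ?leq_addl//= lerDr big_seq sumr_ge0// => j.
  rewrite mem_index_iota => /andP[j1 _].
  by rewrite mulr_ge0 ?sqr_ge0 ?ltW ?(lambda_gt0 spec).
exact: lerD (lerD (lexx _) low) high.
Qed.
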